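(* Let $(A,\varphi,\phi_A,[\cdot,\cdot]_A,a_A)$ be a Hom-Lie algebroid over $M$ whose underlying Hom-bundle is invertible (in particular $\varphi:M\to M$ is a diffeomorphism). Then the anchor $a_A$ is a morphism of Hom-Lie algebroids from $(A,\varphi,\phi_A,[\cdot,\cdot]_A,a_A)$ to the Hom-Lie algebroid $(\varphi^!TM,\varphi,\mathrm{Ad}_{\varphi^*},[\cdot,\cdot]_{\varphi^*},\mathrm{id})$.
   Context: Manifolds, bundles and maps are smooth; functions are real-valued. A Hom-Lie algebra $(\mathfrak g,[\cdot,\cdot],\phi)$ is a vector space with a skew-symmetric bilinear bracket and a linear map $\phi$ such that $\phi[x,y]=[\phi(x),\phi(y)]$ and $[\phi(x),[y,z]]+[\phi(y),[z,x]]+[\phi(z),[x,y]]=0$. A representation of it on a vector space $V$ with respect to $\beta\in\mathfrak{gl}(V)$ is a linear map $\rho:\mathfrak g\to\mathfrak{gl}(V)$ with $\rho(\phi(x))\circ\beta=\beta\circ\rho(x)$ and $\rho([x,y])\circ\beta=\rho(\phi(x))\circ\rho(y)-\rho(\phi(y))\circ\rho(x)$. For $\varphi:M\to M$, $\varphi^*f=f\circ\varphi$. A Hom-bundle $(A\to M,\varphi,\phi_A)$ is a vector bundle $A\to M$ with a smooth map $\varphi:M\to M$ and a linear map $\phi_A:\Gamma(A)\to\Gamma(A)$ such that $\phi_A(fx)=\varphi^*(f)\phi_A(x)$; it is invertible if $\varphi$ is a diffeomorphism and $\phi_A$ is invertible. $\varphi^!TM$ is the pullback bundle of $TM$; a section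 $x$ acts on functions by $x(f)(m)=x_m(f)$, where $x_m\in T_{\varphi(m)}M$. When $\varphi$ is a diffeomorphism, $\Gamma(\varphi^!TM)$ is thereby identified with the set of $(\varphi^*,\varphi^* )$-derivations of $C^\infty(M)$, i.e. linear maps $x$ with $x(fg)=x(f)\varphi^*(g)+\varphi^*(f)x(g)$. A Hom-Lie algebroid $(A,\varphi,\phi_A,[\cdot,\cdot]_A,a_A)$ is a Hom-bundle $(A\to M,\varphi,\phi_A)$ with a Hom-Lie algebra structure $(\Gamma(A),[\cdot,\cdot]_A,\phi_A)$ and a bundle map $a_A:A\to\varphi^!TM$ (anchor) such that (i) $[x,fy]_A=\varphi^*(f)[x,y]_A+a_A(\phi_A(x))(f)\,\phi_A(y)$ for $x,y\in\Gamma(A)$, $f\in C^\infty(M)$; (ii) $a_A$ is a representation of $(\Gamma(A),[\cdot,\cdot]_A,\phi_A)$ on $C^\infty(M)$ with respect to $\varphi^*$. For a diffeomorphism $\varphi$, $(\varphi^!TM,\varphi,\mathrm{Ad}_{\varphi^*},[\cdot,\cdot]_{\varphi^*},\mathrm{id})$ is a Hom-Lie algebroid, where $\mathrm{Ad}_{\varphi^*}(x)=\varphi^*\circ x\circ(\varphi^* )^{-1}$ and $[x,y]_{\varphi^*}=\varphi^*\circ x\circ(\varphi^* )^{-1}\circ y\circ(\varphi^* )^{-1}-\varphi^*\circ y\circ(\varphi^* )^{-1}\circ x\circ(\varphi^* )^{-1}$. A morphism between Hom-Lie algebroids $(A,\varphi,\phi_A,[\cdot,\cdot]_A,a_A)$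 and $(B,\varphi,\phi_B,[\cdot,\cdot]_B,a_B)$ over the same base $M$ is a bundle map $\sigma:A\to B$ such that for all $x,y\in\Gamma(A)$: $a_B\circ\sigma=a_A$, $\sigma(\phi_A(x))=\phi_B(\sigma(x))$, $\sigma([x,y]_A)=[\sigma(x),\sigma(y)]_B$. *)

(* Defs.v *)
From HB Require Import structures.
From mathcomp Require Import all_boot all_order all_algebra.
From mathcomp Require Import all_classical all_reals.
From mathcomp Require Import topology normedtype landau derive.

Set Implicit Arguments.
Unset Strict Implicit.
Unset Printing Implicit Defensive.

Import Order.TTheory GRing.Theory Num.Theory.
Import numFieldNormedType.Exports.

Local Open Scope classical_set_scope.
Local Open Scope ring_scope.

Section Calculus.
Context {R : realType}.

(* In finite dimension this is the usual class C^k on the open set U: f is C^0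
   when continuous, and C^(k+1) when differentiable at every point of U with
   all its directional derivatives of class C^k on U. *)
Fixpoint Ck {n} (k : nat) (U : set 'rV[R]_n) (f : 'rV[R]_n -> R) : Prop :=
  if k is k'.+1 then
    (forall x, U x -> differentiable f x) /\
    (forall v, Ck k' U (fun x => 'd f x v))
  else forall x, U x -> {for x, continuous f}.

Definition smooth_on {n} (U : set 'rV[R]_n) (f : 'rV[R]_n -> R) : Prop :=
  forall k, Ck k U f.

Definition smooth_map_on {m n} (U : set 'rV[R]_m) (F : 'rV[R]_m -> 'rV[R]_n) :=
  forall j, smooth_on U (fun x => F x 0 j).

Lemma near_eq_diff (V W : normedModType R) (f g : V -> W) (x : V) :
  (\near x, f x = g x) -> differentiable f x ->
  differentiable g x /\ 'd g x = 'd f x :> (V -> W).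
Proof.
move=> fg df.
have E : 'd g x = 'd f x :> (V -> W).
  apply: diff_unique; first exact: diff_continuous.
  have /eqaddoP H := diff_locally df; apply/eqaddoP => e e0.
  have := H e e0; apply: filterS2.
  - by move=> h; exact.
  - have : \forall h \near (0:V), f (shift x h) = g (shift x h).
      by move: fg; rewrite (near_shift 0 x) subr0; apply: filterS.
    apply: filterS => h /= E.
    by rewrite !fctE /= -E (nbhs_singleton fg).
split => //; apply/diff_locallyP; rewrite E.
split; first exact: diff_continuous.
have /eqaddoP H := diff_locally df; apply/eqaddoP => e e0.
have := H e e0; apply: filterS2.
- by move=> h; exact.
- have : \forall h \near (0:V), f (shift x h) = g (shift x h).
    by move: fg; rewrite (near_shift 0 x) subr0; apply: filterS.
  apply: filterS => h /= E'.
  by rewrite !fctE /= -E' (nbhs_singleton fg).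
Qed.

Section Coord.
Variables (n : nat) (j : 'I_n).
Definition coord_row (N : 'rV[R]_n) : R := N 0 j.
Fact coord_row_linear : linear coord_row.
Proof. by move=> a u v; rewrite /coord_row !mxE. Qed.
HB.instance Definition _ :=
  GRing.isLinear.Build R 'rV[R]_n R _ coord_row coord_row_linear.
Lemma coord_row_continuous : continuous coord_row.
Proof. exact: coord_continuous. Qed.
End Coord.

Lemma diff_comp_at (U V W : normedModType R) (h : U -> V) (g : V -> W) x y v :
  h x = y -> differentiable h x -> differentiable g y ->
  differentiable (g \o h) x /\ 'd (g \o h) x v = 'd g y ('d h x v).
Proof.
move=> <- dh dg; split; first exact: differentiable_comp.
by rewrite (diff_comp dh dg).
Qed.

Section Ck.
Variable n : nat.
Implicit Types (U : set 'rV[R]_n) (f g : 'rV[R]_n -> R).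

Lemma Ck_eq k U f g : open U -> (forall x, U x -> f x = g x) ->
  Ck k U f -> Ck k U g.
Proof.
move=> oU; elim: k f g => [|k IH] f g fg.
  move=> cf x Ux; have nfg : \near x, f x = g x.
    by apply: filterS (open_nbhs_nbhs (conj oU Ux)) => y; exact: fg.
  rewrite /prop_for /continuous_at -fg//.
  exact: cvg_trans (near_eq_cvg nfg) (cf x Ux).
move=> [df cf].
have H x : U x -> differentiable g x /\ 'd g x = 'd f x :> (_ -> _).
  move=> Ux; apply: near_eq_diff (df x Ux).
  by apply: filterS (open_nbhs_nbhs (conj oU Ux)) => y; exact: fg.
split=> [x /H[]//|v]; apply: IH (cf v) => x /H[_ ->]//.
Qed.

Lemma Ck_local k U f :
  (forall x, U x -> exists2 U', U' x & Ck k U' f) -> Ck k U f.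
Proof.
elim: k f => [|k IH] f H; first by move=> x /H[U' U'x /(_ x U'x)].
split=> [x /H[U' U'x [/(_ x U'x) df _]]|v]; first exact: df.
by apply: IH => x /H[U' U'x [_ cf]]; exists U' => //; exact: cf.
Qed.

Lemma Ck_sub k U U' f : U' `<=` U -> Ck k U f -> Ck k U' f.
Proof. by move=> UU H; apply: Ck_local => x /UU Ux; exists U. Qed.

Lemma CkW k U f : Ck k.+1 U f -> Ck k U f.
Proof.
elim: k f => [|k IH] f [df cf].
  by move=> x Ux; exact/differentiable_continuous/df.
by split=> [x /df|v] //; exact/IH/cf.
Qed.

Lemma Ck_cst k U (c : R) : open U -> Ck k U (fun=> c).
Proof.
move=> oU; elim: k c => [|k IH] c; first by move=> x Ux; exact: cst_continuous.
split=> [x Ux|v]; first exact: differentiable_cst.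
by apply: Ck_eq (IH 0) => // x Ux; rewrite -/(cst c) diff_cst.
Qed.

Lemma CkD k U f g : open U -> Ck k U f -> Ck k U g ->
  Ck k U (fun x => f x + g x).
Proof.
move=> oU; elim: k f g => [|k IH] f g.
  by move=> cf cg x Ux; exact: (continuousD (cf x Ux) (cg x Ux)).
move=> [df cf] [dg cg]; split=> [x Ux|v].
  by apply: differentiableD; [exact: df|exact: dg].
apply: Ck_eq (IH _ _ (cf v) (cg v)) => // x Ux.
by rewrite (@diffD _ _ _ f g) //; [exact: df|exact: dg].
Qed.

Lemma CkM k U f g : open U -> Ck k U f -> Ck k U g ->
  Ck k U (fun x => f x * g x).
Proof.
move=> oU; elim: k f g => [|k IH] f g.
  by move=> cf cg x Ux; exact: (continuousM (cf x Ux) (cg x Ux)).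
move=> Cf Cg; have [df cf] := Cf; have [dg cg] := Cg; split=> [x Ux|v].
  by apply: differentiableM; [exact: df|exact: dg].
have := CkD oU (IH _ _ (CkW Cf) (cg v)) (IH _ _ (CkW Cg) (cf v)).
apply: Ck_eq => // x Ux.
by rewrite (@diffM _ _ f g) //; [exact: df|exact: dg].
Qed.

Lemma Ck_sum k U (I : Type) (r : seq I) (F : I -> 'rV[R]_n -> R) : open U ->
  (forall i, Ck k U (F i)) -> Ck k U (fun x => \sum_(i <- r) F i x).
Proof.
move=> oU H; elim: r => [|i r IH].
  by apply: Ck_eq (Ck_cst k 0 oU) => // x Ux; rewrite big_nil.
by apply: Ck_eq (CkD oU (H i) IH) => // x Ux; rewrite big_cons.
Qed.

Lemma Ck_coord k U (j : 'I_n) : open U -> Ck k U (fun x => x 0 j).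
Proof.
move=> oU.
have df x : differentiable (fun x : 'rV[R]_n => x 0 j) x.
  exact: differentiable_coord.
case: k => [|k]; first by move=> x _; exact: differentiable_continuous.
split=> // v; apply: Ck_eq (Ck_cst k (v 0 j) oU) => // x _.
rewrite -[fun x0 => _]/(coord_row j) diff_lin //; exact: coord_row_continuous.
Qed.

End Ck.

Section Vector.
Variables m n : nat.
Implicit Types (U : set 'rV[R]_m) (F : 'rV[R]_m -> 'rV[R]_n).

Lemma differentiable_row F x :
  (forall j, differentiable (fun y => F y 0 j) x) -> differentiable F x.
Proof.
move=> dF.
have -> : F = \sum_(j < n) (fun y => F y 0 j *: delta_mx 0 j).
  by apply/funext => y; rewrite fct_sumE -row_sum_delta.
by apply: differentiable_sum => j; exact: differentiableZl.
Qed.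

Lemma diff_row F x v j : differentiable F x ->
  'd F x v 0 j = 'd (fun y => F y 0 j) x v.
Proof.
move=> dF.
have cl := @coord_row_continuous n j.
rewrite -[fun y => F y 0 j]/(coord_row j \o F).
rewrite (@diff_comp _ _ _ _ F (coord_row j)) //; last first.
  exact: differentiable_coord.
by rewrite /= (@diff_lin _ _ _ (coord_row j)).
Qed.

Lemma smooth_map_differentiable U F x : smooth_map_on U F -> U x ->
  differentiable F x.
Proof.
by move=> sF Ux; apply: differentiable_row => j; have [/(_ x Ux)] := sF j 1%N.
Qed.

Lemma Ck_comp k U (W : set 'rV[R]_n) F (g : 'rV[R]_n -> R) :
  open U -> (forall x, U x -> W (F x)) ->
  (forall j, Ck k U (fun x => F x 0 j)) -> Ck k W g -> Ck k U (g \o F).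
Proof.
move=> oU UW; elim: k g => [|k IH] g.
  move=> cF cg x Ux; apply: continuous_comp; last exact/cg/UW.
  have -> : F = \sum_(j < n) (fun y => F y 0 j *: delta_mx 0 j).
    by apply/funext => y; rewrite fct_sumE -row_sum_delta.
  elim/big_ind: _ => [|f h|j _]; first exact: cst_continuous.
  - exact: continuousD.
  - exact: (continuousZr_tmp (cF j x Ux)).
move=> CF [dg cg].
have dF x : U x -> differentiable F x.
  by move=> Ux; apply: differentiable_row => j; have [/(_ x Ux)] := CF j.
split=> [x Ux|v]; first by apply: differentiable_comp; [exact: dF|exact/dg/UW].
have H : Ck k U (fun x => \sum_(j < n)
    'd (fun y => F y 0 j) x v * 'd g (F x) (delta_mx 0 j)).
  apply: Ck_sum => // j; apply: CkM => //; first by have [_] := CF j; exact.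
  by apply: (IH (fun y => 'd g y _)) => [i|]; [exact: CkW|exact: cg].
apply: Ck_eq H => // x Ux.
rewrite (@diff_comp _ _ _ _ F g) /=; [|exact: dF|exact/dg/UW].
rewrite [in RHS](row_sum_delta ('d F x v)) linear_sum; apply: eq_bigr => j _.
by rewrite linearZ /= diff_row //; exact: dF.
Qed.

End Vector.
End Calculus.

(* A homeomorphism from chart_dom onto the open set chart_map @` chart_dom of
   R^n, with inverse chart_inv; values of chart_map outside chart_dom, and of
   chart_inv outside the image, are irrelevant. *)
Record chart (R : realType) (n : nat) (M : topologicalType) := Chart {
  chart_dom : set M;
  chart_map :> M -> 'rV[R]_n;
  chart_inv : 'rV[R]_n -> M;
  chart_dom_open : open chart_dom;
  chart_im_open : open (chart_map @` chart_dom);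
  chart_mapK : forall p, chart_dom p -> chart_inv (chart_map p) = p;
  chart_map_continuous :
    forall p, chart_dom p -> {for p, continuous chart_map};
  chart_inv_continuous :
    forall x, (chart_map @` chart_dom) x -> {for x, continuous chart_inv}
}.

(* The atlas is indexed by a type and need not be maximal. *)
Record manifold (R : realType) (n : nat) := Manifold {
  mf_space :> topologicalType;
  mf_hausdorff : hausdorff_space mf_space;
  mf_second_countable : @second_countable mf_space;
  mf_atlas : Type;
  mf_chart : mf_atlas -> chart R n mf_space;
  mf_cover : forall p, exists i, chart_dom (mf_chart i) p;
  mf_compat : forall i j, smooth_map_on
    (mf_chart i @` (chart_dom (mf_chart i) `&` chart_dom (mf_chart j)))
    (mf_chart j \o chart_inv (mf_chart i))
}.

Section SmoothFunctions.
Context {R : realType} {n : nat} (M : manifold R n).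
Implicit Types (i j : mf_atlas M) (f g : M -> R) (W : set M).

Local Notation c := (@mf_chart R n M).
Local Notation dom i := (chart_dom (c i)).
Local Notation cinv i := (chart_inv (c i)).

(* Smoothness of the restriction of f to the open set W. *)
Definition smooth_fun_on (W : set M) (f : M -> R) : Prop :=
  forall i, smooth_on (c i @` (dom i `&` W)) (f \o cinv i).

Lemma chart_image_open i W : open W -> open (c i @` (dom i `&` W)).
Proof.
move=> oW; rewrite openE => _ [p [dp Wp] <-]; rewrite /interior.
have H1 : nbhs (c i p) (c i @` dom i).
  by apply: open_nbhs_nbhs; split; [exact: chart_im_open|exists p].
have H2 : \forall y \near c i p, W (cinv i y).
  have /(_ W) := @chart_inv_continuous _ _ _ (c i) (c i p) (imageP _ dp).
  by apply; rewrite chart_mapK//; apply: open_nbhs_nbhs.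
apply: filterS2 H1 H2 => _ [q dq <-]; rewrite chart_mapK// => Wq.
by exists q.
Qed.

Lemma smooth_fun_local W f :
  (forall p, W p -> exists i N, [/\ dom i p, open N, N p &
     smooth_on (c i @` (dom i `&` N)) (f \o cinv i)]) -> smooth_fun_on W f.
Proof.
move=> H j k; apply: Ck_local => _ [p [dp Wp] <-].
have [i [N [di oN Np sf]]] := H p Wp.
have oU : open (c j @` (dom j `&` (dom i `&` N))).
  by apply: chart_image_open; apply: openI => //; exact: chart_dom_open.
exists (c j @` (dom j `&` (dom i `&` N))); first by exists p.
have : Ck k (c j @` (dom j `&` (dom i `&` N)))
    ((f \o cinv i) \o (c i \o cinv j)).
  apply: (@Ck_comp _ _ _ _ _ (c i @` (dom i `&` N))) => //.
  - move=> _ [q [qj [qi qN]] <-] /=; rewrite chart_mapK//; by exists q.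
  - move=> l; apply: Ck_sub (@mf_compat _ _ M j i l k).
    by move=> _ [q [qj [qi qN]] <-]; exists q.
apply: Ck_eq => // _ [q [qj [qi qN]] <-] /=.
by rewrite !chart_mapK.
Qed.

Lemma smooth_fun_cover W f :
  (forall p, W p -> exists N, [/\ open N, N p & smooth_fun_on N f]) ->
  smooth_fun_on W f.
Proof.
move=> H; apply: smooth_fun_local => p /H[N [oN Np sf]].
by have [i di] := mf_cover p; exists i, N.
Qed.

Lemma smooth_fun_sub W W' f : W' `<=` W -> smooth_fun_on W f ->
  smooth_fun_on W' f.
Proof.
move=> WW H i k; apply: Ck_sub (H i k).
by move=> _ [q [qi qW] <-]; exists q => //; split=> //; exact: WW.
Qed.

Lemma smooth_fun_eq W f g : open W -> (forall p, W p -> f p = g p) ->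
  smooth_fun_on W f -> smooth_fun_on W g.
Proof.
move=> oW fg H i k; apply: Ck_eq (H i k); first exact: chart_image_open.
by move=> _ [q [qi qW] <-] /=; rewrite chart_mapK// fg.
Qed.

Lemma smooth_fun_cst W (a : R) : open W -> smooth_fun_on W (fun=> a).
Proof. by move=> oW i k; apply: Ck_cst; exact: chart_image_open. Qed.

Lemma smooth_funD W f g : open W -> smooth_fun_on W f -> smooth_fun_on W g ->
  smooth_fun_on W (fun p => f p + g p).
Proof.
by move=> oW sf sg i k; apply: CkD;
  [exact: chart_image_open|exact: sf|exact: sg].
Qed.

Lemma smooth_funM W f g : open W -> smooth_fun_on W f -> smooth_fun_on W g ->
  smooth_fun_on W (fun p => f p * g p).
Proof.
by move=> oW sf sg i k; apply: CkM;
  [exact: chart_image_open|exact: sf|exact: sg].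
Qed.

Lemma smooth_fun_sum W (I : Type) (r : seq I) (F : I -> M -> R) : open W ->
  (forall x : I, smooth_fun_on W (F x)) ->
  smooth_fun_on W (fun p => \sum_(i <- r) F i p).
Proof.
move=> oW sF i k; apply: Ck_sum; first exact: chart_image_open.
by move=> j; exact: sF.
Qed.

Lemma smooth_fun_chart i W (g : 'rV[R]_n -> R) : open W ->
  smooth_on (c i @` (dom i `&` W)) g ->
  smooth_fun_on (dom i `&` W) (g \o c i).
Proof.
move=> oW sg; apply: smooth_fun_local => p [di Wp].
exists i, W; split=> // k.
apply: Ck_eq (sg k); first exact: chart_image_open.
by move=> _ [q [qi qW] <-] /=; rewrite chart_mapK.
Qed.

Record smooth_function := SmoothFunction {
  sf_fun :> M -> R;
  sf_smooth : smooth_fun_on setT sf_fun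
}.

Lemma smooth_functionP (f g : smooth_function) : (f : M -> R) = g -> f = g.
Proof.
case: f g => [f sf] [g sg] /= fg; case: _ / fg sg => sg.
by congr SmoothFunction; exact: Prop_irrelevance.
Qed.

HB.instance Definition _ := gen_eqMixin smooth_function.
HB.instance Definition _ := gen_choiceMixin smooth_function.

Definition sf_zero := SmoothFunction (smooth_fun_cst 0 openT).
Definition sf_add (f g : smooth_function) :=
  SmoothFunction (smooth_funD openT (@sf_smooth f) (@sf_smooth g)).
Definition sf_scale (a : R) (f : smooth_function) :=
  SmoothFunction (smooth_funM openT (smooth_fun_cst a openT) (@sf_smooth f)).

Fact sf_addA : associative sf_add.
Proof.
by move=> f g h; apply/smooth_functionP/funext => p /=; rewrite addrA.
Qed.
Fact sf_addC : commutative sf_add.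
Proof. by move=> f g; apply/smooth_functionP/funext => p /=; rewrite addrC. Qed.
Fact sf_add0 : left_id sf_zero sf_add.
Proof. by move=> f; apply/smooth_functionP/funext => p /=; rewrite add0r. Qed.
Fact sf_addN : left_inverse sf_zero (sf_scale (-1)) sf_add.
Proof.
by move=> f; apply/smooth_functionP/funext => p /=; rewrite mulN1r addNr.
Qed.
HB.instance Definition _ := GRing.isZmodule.Build smooth_function
  sf_addA sf_addC sf_add0 sf_addN.

Fact sf_scaleA a b (f : smooth_function) :
  sf_scale a (sf_scale b f) = sf_scale (a * b) f.
Proof. by apply/smooth_functionP/funext => p /=; rewrite mulrA. Qed.
Fact sf_scale1 : left_id 1 sf_scale.
Proof. by move=> f; apply/smooth_functionP/funext => p /=; rewrite mul1r. Qed.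
Fact sf_scaleDr : right_distributive sf_scale +%R.
Proof.
by move=> a f g; apply/smooth_functionP/funext => p /=; rewrite mulrDr.
Qed.
Fact sf_scaleDl (f : smooth_function) : {morph sf_scale^~ f : a b / a + b}.
Proof.
by move=> a b; apply/smooth_functionP/funext => p /=; rewrite mulrDl.
Qed.
HB.instance Definition _ := GRing.Zmodule_isLmodule.Build R smooth_function
  sf_scaleA sf_scale1 sf_scaleDr sf_scaleDl.

End SmoothFunctions.

Section SmoothMaps.
Context {R : realType} {m n : nat}.

Record smooth_map (M : manifold R m) (N : manifold R n) := SmoothMap {
  sm_fun :> M -> N;
  sm_continuous : continuous sm_fun;
  sm_smooth : forall (i : mf_atlas M) (j : mf_atlas N), smooth_map_on
    (mf_chart i @` (chart_dom (mf_chart i) `&`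
                    sm_fun @^-1` chart_dom (mf_chart j)))
    (mf_chart j \o sm_fun \o chart_inv (mf_chart i))
}.

Lemma smooth_fun_comp (M : manifold R m) (N : manifold R n)
    (phi : smooth_map M N) (W : set N) (f : N -> R) : open W ->
  smooth_fun_on W f -> smooth_fun_on (phi @^-1` W) (f \o phi).
Proof.
move=> oW sf; apply: smooth_fun_local => p Wp.
have [i di] := mf_cover p; have [j dj] := mf_cover (phi p).
pose N' := phi @^-1` (chart_dom (mf_chart j) `&` W).
have oN : open N'.
  move/continuousP: (@sm_continuous _ _ phi); apply.
  by apply: openI => //; exact: chart_dom_open.
exists i, N'; split=> // k.
have : Ck k (mf_chart i @` (chart_dom (mf_chart i) `&` N'))
   ((f \o chart_inv (mf_chart j)) \o
    (mf_chart j \o phi \o chart_inv (mf_chart i))).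
  apply: (@Ck_comp _ _ _ _ _ _ _ _ _ _ _ (sf j k)).
  - exact: chart_image_open.
  - move=> _ [q [qi [qj qW]] <-] /=; rewrite chart_mapK//.
    by exists (phi q).
  - move=> l; apply: Ck_sub (@sm_smooth _ _ phi i j l k).
    by move=> _ [q [qi [qj qW]] <-]; exists q.
apply: Ck_eq; first exact: chart_image_open.
by move=> _ [q [qi [qj qW]] <-] /=; rewrite !chart_mapK.
Qed.

Fact pullback_fun_smooth (M : manifold R m) (N : manifold R n)
  (phi : smooth_map M N) (f : smooth_function N) :
  smooth_fun_on setT (f \o phi).
Proof. exact: smooth_fun_comp openT (@sf_smooth _ _ _ f). Qed.

Definition pullback_fun (M : manifold R m) (N : manifold R n)
    (phi : smooth_map M N) (f : smooth_function N) : smooth_function M :=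
  SmoothFunction (pullback_fun_smooth phi f).

End SmoothMaps.

Record diffeomorphism (R : realType) (n : nat) (M : manifold R n) :=
  Diffeomorphism {
    diffeo :> smooth_map M M;
    diffeo_inv : smooth_map M M;
    diffeoK : cancel diffeo diffeo_inv;
    diffeo_invK : cancel diffeo_inv diffeo
  }.

Section VectorBundles.
Context {R : realType} {n : nat}.

Definition smooth_mx_on (M : manifold R n) {k l} (W : set M)
    (G : M -> 'M[R]_(k, l)) : Prop :=
  forall a b, smooth_fun_on W (fun p => G p a b).

(* A smooth vector bundle of rank k, as a family of vector spaces with an open
   cover of local trivializations whose transition functions are smooth
   matrix-valued maps (acting on row vectors, hence on the right).  Such data
   determine the topology and the smooth structure of the total space.  The
   transition matrices are invertible because the triv i p are bijective. *)
Record vector_bundle (M : manifold R n) (k : nat) := VectorBundle {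
  fiber :> M -> lmodType R;
  vb_index : Type;
  triv_dom : vb_index -> set M;
  triv : forall (i : vb_index) (p : M), {linear fiber p -> 'rV[R]_k};
  triv_dom_open : forall i, open (triv_dom i);
  triv_cover : forall p, exists i, triv_dom i p;
  triv_bij : forall i p, triv_dom i p -> bijective (triv i p);
  triv_transition : forall i j, exists2 G : M -> 'M[R]_k,
    smooth_mx_on (triv_dom i `&` triv_dom j) G &
    forall p, triv_dom i p -> triv_dom j p ->
      forall v : fiber p, triv j p v = triv i p v *m G p
}.

Section Sections.
Context {M : manifold R n} {k : nat} (E : vector_bundle M k).

Record smooth_section := SmoothSection {
  sec_fun :> forall p, E p;
  sec_smooth : forall i l,
    smooth_fun_on (triv_dom i) (fun p => triv i p (sec_fun p) 0 l)
}.

Lemma smooth_sectionP (x y : smooth_section) : (forall p, x p = y p) -> x = y.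
Proof.
case: x y => [x sx] [y sy] /= xy.
have {}xy : x = y by apply: functional_extensionality_dep.
by case: _ / xy sy => sy; congr SmoothSection; exact: Prop_irrelevance.
Qed.

HB.instance Definition _ := gen_eqMixin smooth_section.
HB.instance Definition _ := gen_choiceMixin smooth_section.

Fact sec_zero_smooth i l :
  smooth_fun_on (triv_dom i) (fun p => triv i p (0 : E p) 0 l).
Proof.
have oi := @triv_dom_open _ _ E i.
apply: smooth_fun_eq (smooth_fun_cst 0 oi) => //.
by move=> p _; rewrite linear0 mxE.
Qed.
Definition sec_zero := SmoothSection sec_zero_smooth.

Fact sec_add_smooth (x y : smooth_section) i l :
  smooth_fun_on (triv_dom i) (fun p => triv i p (x p + y p) 0 l).
Proof.
have oi := @triv_dom_open _ _ E i.
apply: smooth_fun_eq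
  (smooth_funD oi (@sec_smooth x i l) (@sec_smooth y i l)) => //.
by move=> p _; rewrite linearD mxE.
Qed.
Definition sec_add x y := SmoothSection (sec_add_smooth x y).

Fact fun_sec_mul_smooth (f : smooth_function M) (x : smooth_section) i l :
  smooth_fun_on (triv_dom i) (fun p => triv i p (f p *: x p) 0 l).
Proof.
have oi := @triv_dom_open _ _ E i.
have sf : smooth_fun_on (triv_dom i) f.
  by apply: smooth_fun_sub (sf_smooth f).
apply: smooth_fun_eq (smooth_funM oi sf (@sec_smooth x i l)) => //.
by move=> p _; rewrite linearZ mxE.
Qed.
Definition fun_sec_mul (f : smooth_function M) (x : smooth_section) :=
  SmoothSection (fun_sec_mul_smooth f x).

Fact sec_scale_smooth (a : R) (x : smooth_section) i l :
  smooth_fun_on (triv_dom i) (fun p => triv i p (a *: x p) 0 l).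
Proof.
exact: fun_sec_mul_smooth (SmoothFunction (smooth_fun_cst a openT)) x i l.
Qed.
Definition sec_scale (a : R) (x : smooth_section) :=
  SmoothSection (sec_scale_smooth a x).

Fact sec_addA : associative sec_add.
Proof. by move=> x y z; apply: smooth_sectionP => p /=; rewrite addrA. Qed.
Fact sec_addC : commutative sec_add.
Proof. by move=> x y; apply: smooth_sectionP => p /=; rewrite addrC. Qed.
Fact sec_add0 : left_id sec_zero sec_add.
Proof. by move=> x; apply: smooth_sectionP => p /=; rewrite add0r. Qed.
Fact sec_addN : left_inverse sec_zero (sec_scale (-1)) sec_add.
Proof.
by move=> x; apply: smooth_sectionP => p /=; rewrite scaleN1r addNr.
Qed.
HB.instance Definition _ := GRing.isZmodule.Build smooth_section
  sec_addA sec_addC sec_add0 sec_addN.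

Fact sec_scaleA a b x : sec_scale a (sec_scale b x) = sec_scale (a * b) x.
Proof. by apply: smooth_sectionP => p /=; rewrite scalerA. Qed.
Fact sec_scale1 : left_id 1 sec_scale.
Proof. by move=> x; apply: smooth_sectionP => p /=; rewrite scale1r. Qed.
Fact sec_scaleDr : right_distributive sec_scale +%R.
Proof. by move=> a x y; apply: smooth_sectionP => p /=; rewrite scalerDr. Qed.
Fact sec_scaleDl x : {morph sec_scale^~ x : a b / a + b}.
Proof. by move=> a b; apply: smooth_sectionP => p /=; rewrite scalerDl. Qed.
HB.instance Definition _ := GRing.Zmodule_isLmodule.Build R smooth_section
  sec_scaleA sec_scale1 sec_scaleDr sec_scaleDl.

End Sections.

(* Bundle maps over the identity of M: fibrewise linear, and given by smooth
   matrices in local trivializations. *)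
Record bundle_map {M : manifold R n} {k l : nat} (E : vector_bundle M k)
    (F : vector_bundle M l) := BundleMap {
  bm_fun :> forall p, {linear E p -> F p};
  bm_smooth : forall i j, exists2 G : M -> 'M[R]_(k, l),
    smooth_mx_on (triv_dom i `&` triv_dom j) G &
    forall p, triv_dom i p -> triv_dom j p ->
      forall v : E p, triv j p (bm_fun p v) = triv i p v *m G p
}.

Section MapSection.
Context {M : manifold R n} {k l : nat}.
Context {E : vector_bundle M k} {F : vector_bundle M l}.

Fact bm_section_smooth (s : bundle_map E F) (x : smooth_section E) j b :
  smooth_fun_on (triv_dom j) (fun p => triv j p (s p (x p)) 0 b).
Proof.
apply: smooth_fun_cover => p dj; have [i di] := @triv_cover _ _ E p.
have [G sG GE] := bm_smooth s i j.
have oW : open (triv_dom i `&` triv_dom j).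
  by apply: openI; exact: triv_dom_open.
exists (triv_dom i `&` triv_dom j); split=> //.
have H : smooth_fun_on (triv_dom i `&` triv_dom j)
    (fun p => \sum_(a < k) triv i p (x p) 0 a * G p a b).
  apply: smooth_fun_sum => // a; apply: smooth_funM => //.
  by apply: smooth_fun_sub (@sec_smooth _ _ _ x i a) => q [].
by apply: smooth_fun_eq H => // q [qi qj]; rewrite GE// mxE.
Qed.

Definition bm_section (s : bundle_map E F) (x : smooth_section E) :
    smooth_section F := SmoothSection (bm_section_smooth s x).

End MapSection.

Section IdBundleMap.
Context {M : manifold R n} {k : nat} (E : vector_bundle M k).

Fact id_bundle_map_smooth i j : exists2 G : M -> 'M[R]_k,
    smooth_mx_on (triv_dom i `&` triv_dom j) G &
    forall p, triv_dom i p -> triv_dom j p ->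
      forall v : E p, triv j p (idfun v) = triv i p v *m G p.
Proof. exact: triv_transition. Qed.

Definition id_bundle_map : bundle_map E E :=
  @BundleMap M k k E E (fun=> idfun) id_bundle_map_smooth.

End IdBundleMap.

End VectorBundles.

Section PullbackBundle.
Context {R : realType} {m n : nat} {M : manifold R m} {N : manifold R n}.
Context (phi : smooth_map M N) {k : nat} (E : vector_bundle N k).

Fact pullback_dom_open (i : vb_index E) : open (phi @^-1` triv_dom i).
Proof.
move/continuousP: (@sm_continuous _ _ _ _ _ phi); apply; exact: triv_dom_open.
Qed.

Fact pullback_cover p : exists i : vb_index E, (phi @^-1` triv_dom i) p.
Proof. exact: triv_cover. Qed.

Fact pullback_transition (i j : vb_index E) : exists2 G : M -> 'M[R]_k,
  smooth_mx_on ((phi @^-1` triv_dom i) `&` (phi @^-1` triv_dom j)) G &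
  forall p, (phi @^-1` triv_dom i) p -> (phi @^-1` triv_dom j) p ->
    forall v : E (phi p), triv j (phi p) v = triv i (phi p) v *m G p.
Proof.
have [G sG GE] := @triv_transition _ _ _ _ E i j.
exists (G \o phi); last by move=> p; exact: GE.
move=> a b; apply: (smooth_fun_comp phi _ (sG a b)).
by apply: openI; exact: triv_dom_open.
Qed.

Definition pullback_bundle : vector_bundle M k :=
  @VectorBundle R m M k (fun p => E (phi p)) (vb_index E)
    (fun i => phi @^-1` triv_dom i) (fun i p => triv i (phi p))
    pullback_dom_open pullback_cover
    (fun i p => @triv_bij _ _ _ _ E i (phi p)) pullback_transition.

End PullbackBundle.

Section TangentBundle.
Context {R : realType} {n : nat} (M : manifold R n).
Implicit Types (i j : mf_atlas M) (p : M).

Local Notation c := (@mf_chart R n M).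
Local Notation dom i := (chart_dom (c i)).
Local Notation cinv i := (chart_inv (c i)).

Definition coord_change i j : 'rV[R]_n -> 'rV[R]_n := c j \o cinv i.

Lemma coord_change_diff i j p : dom i p -> dom j p ->
  differentiable (coord_change i j) (c i p).
Proof.
by move=> di dj; apply: smooth_map_differentiable (mf_compat i j) _; exists p.
Qed.

Lemma near_chart i (W : set M) p : dom i p -> open W -> W p ->
  \forall y \near c i p, exists q, [/\ dom i q, W q & c i q = y].
Proof.
move=> di oW Wp.
have : nbhs (c i p) (c i @` (dom i `&` W)).
  by apply: open_nbhs_nbhs; split; [exact: chart_image_open|exists p].
by apply: filterS => _ [q [qi qW] <-]; exists q.
Qed.

Lemma diff_change_chart (V : normedModType R) (f : M -> V) i j p v :
  dom i p -> dom j p -> differentiable (f \o cinv j) (c j p) ->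
  'd (f \o cinv i) (c i p) v =
  'd (f \o cinv j) (c j p) ('d (coord_change i j) (c i p) v).
Proof.
move=> di dj df; have dij := coord_change_diff di dj.
have E : coord_change i j (c i p) = c j p.
  by rewrite /coord_change /comp chart_mapK.
have [dfc Ec] := diff_comp_at v E dij df.
refine (etrans _ Ec).
have H : \forall y \near c i p,
    ((f \o cinv j) \o coord_change i j) y = (f \o cinv i) y.
  apply: filterS (near_chart di (chart_dom_open (c j)) dj).
  by move=> _ [q [qi qj <-]]; rewrite /coord_change /comp !chart_mapK.
have [_ Ed] := near_eq_diff H dfc.
exact: (congr1 (fun F => F v) Ed).
Qed.

Lemma coord_change_id i p v : dom i p -> 'd (coord_change i i) (c i p) v = v.
Proof.
move=> di; have H : \forall y \near c i p, id y = coord_change i i y.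
  apply: filterS (near_chart di (chart_dom_open (c i)) di).
  by move=> _ [q [qi _ <-]]; rewrite /coord_change /comp chart_mapK.
have [_ Ed] := near_eq_diff H (@ex_diff _ _ _ _ _ _ _ (is_diff_id _)).
apply: etrans (congr1 (fun F => F v) Ed) _.
by rewrite (@diff_val _ _ _ _ _ _ _ (is_diff_id _)).
Qed.

(* A tangent vector at p is a family of coordinate vectors, one per chart
   around p, related by the differentials of the changes of coordinates; the
   components at the charts that do not contain p are set to 0. *)
Definition tangent_coherent p (v : mf_atlas M -> 'rV[R]_n) : Prop :=
  (forall i, ~ dom i p -> v i = 0) /\
  (forall i j, dom i p -> dom j p -> v j = 'd (coord_change i j) (c i p) (v i)).

Record tangent p := Tangent {
  tangent_coord :> mf_atlas M -> 'rV[R]_n;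
  tangent_coordP : tangent_coherent p tangent_coord
}.

Section TangentSpace.
Variable p : M.

Lemma tangentP (v w : tangent p) : (forall i, v i = w i) -> v = w.
Proof.
case: v w => [v sv] [w sw] /= vw.
have {}vw : v = w by apply: funext.
by case: _ / vw sw => sw; congr Tangent; exact: Prop_irrelevance.
Qed.

HB.instance Definition _ := gen_eqMixin (tangent p).
HB.instance Definition _ := gen_choiceMixin (tangent p).

Fact tangent_zeroP : tangent_coherent p (fun=> 0).
Proof. by split=> // i j _ _; rewrite linear0. Qed.
Definition tangent_zero := Tangent tangent_zeroP.

Fact tangent_addP (v w : tangent p) :
  tangent_coherent p (fun i => v i + w i).
Proof.
case: v w => [v [v0 vP]] [w [w0 wP]]; split=> [i ni|i j di dj] /=.
  by rewrite v0 // w0 // addr0.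
by rewrite linearD (vP i j) // (wP i j).
Qed.
Definition tangent_add v w := Tangent (tangent_addP v w).

Fact tangent_scaleP (a : R) (v : tangent p) :
  tangent_coherent p (fun i => a *: v i).
Proof.
case: v => [v [v0 vP]]; split=> [i ni|i j di dj] /=.
  by rewrite v0 // scaler0.
by rewrite linearZ (vP i j).
Qed.
Definition tangent_scale a v := Tangent (tangent_scaleP a v).

Fact tangent_addA : associative tangent_add.
Proof. by move=> x y z; apply: tangentP => i /=; rewrite addrA. Qed.
Fact tangent_addC : commutative tangent_add.
Proof. by move=> x y; apply: tangentP => i /=; rewrite addrC. Qed.
Fact tangent_add0 : left_id tangent_zero tangent_add.
Proof. by move=> x; apply: tangentP => i /=; rewrite add0r. Qed.
Fact tangent_addN : left_inverse tangent_zero (tangent_scale (-1)) tangent_add.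
Proof. by move=> x; apply: tangentP => i /=; rewrite scaleN1r addNr. Qed.
HB.instance Definition _ := GRing.isZmodule.Build (tangent p)
  tangent_addA tangent_addC tangent_add0 tangent_addN.

Fact tangent_scaleA a b x :
  tangent_scale a (tangent_scale b x) = tangent_scale (a * b) x.
Proof. by apply: tangentP => i /=; rewrite scalerA. Qed.
Fact tangent_scale1 : left_id 1 tangent_scale.
Proof. by move=> x; apply: tangentP => i /=; rewrite scale1r. Qed.
Fact tangent_scaleDr : right_distributive tangent_scale +%R.
Proof. by move=> a x y; apply: tangentP => i /=; rewrite scalerDr. Qed.
Fact tangent_scaleDl x : {morph tangent_scale^~ x : a b / a + b}.
Proof. by move=> a b; apply: tangentP => i /=; rewrite scalerDl. Qed.
HB.instance Definition _ := GRing.Zmodule_isLmodule.Build R (tangent p)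
  tangent_scaleA tangent_scale1 tangent_scaleDr tangent_scaleDl.

Definition tangent_in_chart i (v : tangent p) : 'rV[R]_n := v i.
Fact tangent_in_chart_linear i : linear (tangent_in_chart i).
Proof. by []. Qed.
HB.instance Definition _ i := GRing.isLinear.Build R (tangent p) 'rV[R]_n _
  (tangent_in_chart i) (tangent_in_chart_linear i).

Definition tangent_of_coord i (w : 'rV[R]_n) : mf_atlas M -> 'rV[R]_n :=
  fun j => if `[< dom i p /\ dom j p >]
           then 'd (coord_change i j) (c i p) w else 0.

Fact tangent_of_coordP i w : tangent_coherent p (tangent_of_coord i w).
Proof.
split=> [j nj|j k dj dk]; rewrite /tangent_of_coord.
  by case: asboolP => // -[].
have [di|ndi] := pselect (dom i p); last first.
  by rewrite !asboolF ?linear0 // => -[].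
rewrite !asboolT //.
exact: (@diff_change_chart _ (c k) i j p w di dj (coord_change_diff dj dk)).
Qed.

Fact tangent_in_chart_bij i : dom i p -> bijective (tangent_in_chart i).
Proof.
move=> di; exists (fun w => Tangent (tangent_of_coordP i w)).
  move=> v; apply: tangentP => j; rewrite /= /tangent_of_coord.
  case: asboolP => [[_ dj]|nij].
    by case: v => [v [v0 vP]] /=; rewrite /tangent_in_chart /= -vP.
  case: v => [v [v0 vP]] /=; rewrite v0 // => dj; exact: nij.
move=> w; rewrite /tangent_in_chart /= /tangent_of_coord asboolT //.
exact: coord_change_id.
Qed.

End TangentSpace.

Fact tangent_transition i j : exists2 G : M -> 'M[R]_n,
  smooth_mx_on (dom i `&` dom j) G &
  forall p, dom i p -> dom j p -> forall v : tangent p,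
    tangent_in_chart j v = tangent_in_chart i v *m G p.
Proof.
exists (fun p => 'J (coord_change i j) (c i p)); last first.
  move=> p di dj [v [v0 vP]]; rewrite /tangent_in_chart /= (vP i j) //.
  by rewrite /jacobian mul_rV_lin1.
move=> a b.
have oj := chart_dom_open (c j).
have H : smooth_on (c i @` (dom i `&` dom j))
    (fun x => 'd (fun y => coord_change i j y 0 b) x (delta_mx 0 a)).
  by move=> k; have [_ ] := mf_compat i j b k.+1; exact.
apply: smooth_fun_eq (smooth_fun_chart oj H).
  by apply: openI => //; exact: chart_dom_open.
move=> p [di dj] /=; rewrite -diff_row; last exact: coord_change_diff.
by rewrite /jacobian mxE.
Qed.

Definition tangent_bundle : vector_bundle M n :=
  @VectorBundle R n M n (fun p => tangent p : lmodType R) (mf_atlas M)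
    (fun i => dom i) (fun i p => @tangent_in_chart p i)
    (fun i => chart_dom_open (c i)) (@mf_cover _ _ M)
    (fun i p => @tangent_in_chart_bij p i) tangent_transition.

Definition chart_at p : mf_atlas M := sval (cid (mf_cover p)).

Lemma chart_atP p : dom (chart_at p) p.
Proof. exact: svalP (cid (mf_cover p)). Qed.

(* v(f); the chart used to compute it does not matter, see tangent_actE. *)
Definition tangent_act p (v : tangent p) (f : M -> R) : R :=
  'd (f \o cinv (chart_at p)) (c (chart_at p) p) (v (chart_at p)).

Lemma tangent_actE p (v : tangent p) (f : smooth_function M) i : dom i p ->
  tangent_act v f = 'd (f \o cinv i) (c i p) (v i).
Proof.
move=> di; have dp := chart_atP p; case: v => [v [v0 vP]].
rewrite /tangent_act /= (vP (chart_at p) i) //.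
apply: diff_change_chart => //; have [+ _] := @sf_smooth _ _ _ f i 1%N.
by apply; exists p.
Qed.

End TangentBundle.

Section HomLie.
Context {R : realType}.

Definition is_hom_lie_algebra (g : lmodType R) (br : g -> g -> g)
    (phi : g -> g) : Prop :=
  [/\ linear phi,
      (forall x, linear (br x)) /\ (forall y, linear (br^~ y)),
      forall x y, br x y = - br y x,
      forall x y, phi (br x y) = br (phi x) (phi y) &
      forall x y z, br (phi x) (br y z) + br (phi y) (br z x)
                    + br (phi z) (br x y) = 0].

Definition is_representation (g : lmodType R) (br : g -> g -> g) (phi : g -> g)
    (V : lmodType R) (beta : V -> V) (rho : g -> V -> V) : Prop :=
  [/\ linear beta,
      (forall x, linear (rho x)) /\ (forall v, linear (rho^~ v)),
      forall x, rho (phi x) \o beta = beta \o rho x &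
      forall x y, rho (br x y) \o beta
        = (fun v => rho (phi x) (rho y v) - rho (phi y) (rho x v))].

End HomLie.

Section HomLieAlgebroids.
Context {R : realType} {n : nat} {M : manifold R n}.

Local Notation pullback_tangent phi := (pullback_bundle phi (tangent_bundle M)).

Section Action.
Variable phi : smooth_map M M.

Fact section_act_smooth (x : smooth_section (pullback_tangent phi))
    (f : smooth_function M) :
  smooth_fun_on setT (fun p => tangent_act (x p : tangent (phi p)) f).
Proof.
apply: smooth_fun_cover => p _; have [i di] := mf_cover (phi p).
have oi := chart_dom_open (mf_chart i).
have oN : open (phi @^-1` chart_dom (mf_chart i)).
  by move/continuousP: (@sm_continuous _ _ _ _ _ phi); apply.
exists (phi @^-1` chart_dom (mf_chart i)); split=> //.
have sf : smooth_on (mf_chart i @` chart_dom (mf_chart i))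
    (f \o chart_inv (mf_chart i)).
  by have := sf_smooth f i; rewrite setIT.
pose F l p := 'd (f \o chart_inv (mf_chart i)) (mf_chart i p)
  (delta_mx 0 l : 'rV[R]_n).
have sF l : smooth_fun_on (phi @^-1` chart_dom (mf_chart i)) (F l \o phi).
  apply: smooth_fun_comp => //; rewrite -[X in smooth_fun_on X]setIT.
  apply: (smooth_fun_chart (g := fun y => 'd _ y (delta_mx 0 l))) openT _.
  by rewrite setIT => k; have [_] := sf k.+1; exact.
have H : smooth_fun_on (phi @^-1` chart_dom (mf_chart i)) (fun p =>
    \sum_(l < n) (x p : tangent (phi p)) i 0 l * F l (phi p)).
  apply: smooth_fun_sum => // l; apply: smooth_funM => //; last exact: sF.
  exact: (@sec_smooth _ _ _ _ _ x i l).
apply: smooth_fun_eq H => // q qi.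
rewrite (tangent_actE _ _ qi) [in RHS](row_sum_delta ((x q : tangent _) i)).
by rewrite linear_sum; apply: eq_bigr => l _; rewrite linearZ.
Qed.

(* x(f)(p) = x_p(f), with x_p a tangent vector at phi p. *)
Definition section_act (x : smooth_section (pullback_tangent phi))
    (f : smooth_function M) : smooth_function M :=
  SmoothFunction (section_act_smooth x f).

(* For phi a diffeomorphism, section_act identifies the sections of phi^!TM with
   the linear D : C^oo(M) -> C^oo(M) such that
   D(fg) = D(f) (g o phi) + (f o phi) D(g); this is the inverse identification,
   with value 0 on operators that are not of the form section_act x. *)
Definition section_of_operator (D : smooth_function M -> smooth_function M) :
    smooth_section (pullback_tangent phi) :=
  xget 0 [set x | section_act x = D].

End Action.

(* The data (A, phi, phi_A, [.,.]_A, a_A) of a Hom-Lie algebroid; the axioms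
   are in is_hom_lie_algebroid. *)
Record hom_lie_algebroid_data (phi : smooth_map M M) := HomLieAlgebroidData {
  hla_rank : nat;
  hla_bundle :> vector_bundle M hla_rank;
  hla_hom : smooth_section hla_bundle -> smooth_section hla_bundle;
  hla_bracket : smooth_section hla_bundle -> smooth_section hla_bundle ->
                smooth_section hla_bundle;
  hla_anchor : bundle_map hla_bundle (pullback_tangent phi)
}.

Arguments hla_hom {phi} A x : rename.
Arguments hla_bracket {phi} A x y : rename.

Definition is_hom_bundle (phi : smooth_map M M) (k : nat)
    (A : vector_bundle M k) (phiA : smooth_section A -> smooth_section A) :=
  linear phiA /\
  forall f x,
    phiA (fun_sec_mul f x) = fun_sec_mul (pullback_fun phi f) (phiA x).

Definition is_hom_lie_algebroid (phi : smooth_map M M)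
    (A : hom_lie_algebroid_data phi) : Prop :=
  let phiA := hla_hom A in
  let br := hla_bracket A in
  let a (x : smooth_section A) := section_act (bm_section (hla_anchor A) x) in
  [/\ is_hom_bundle phi phiA,
      is_hom_lie_algebra br phiA,
      forall x y f, br x (fun_sec_mul f y) =
        fun_sec_mul (pullback_fun phi f) (br x y) +
        fun_sec_mul (a (phiA x) f) (phiA y) &
      is_representation br phiA (pullback_fun phi) a].

Definition is_hla_morphism (phi : smooth_map M M)
    (A B : hom_lie_algebroid_data phi) (sigma : bundle_map A B) : Prop :=
  [/\ forall p v, hla_anchor B p (sigma p v) = hla_anchor A p v,
      forall x,
        bm_section sigma (hla_hom A x) = hla_hom B (bm_section sigma x) &
      forall x y, bm_section sigma (hla_bracket A x y) =
        hla_bracket B (bm_section sigma x) (bm_section sigma y)].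

Section TangentAlgebroid.
Variable phi : diffeomorphism M.

Local Notation pb := (pullback_fun phi).
Local Notation pbV := (pullback_fun (diffeo_inv phi)).

Fact pullback_funK : cancel pb pbV.
Proof.
by move=> f; apply/smooth_functionP/funext => p /=; rewrite diffeo_invK.
Qed.

Fact pullback_funVK : cancel pbV pb.
Proof.
by move=> f; apply/smooth_functionP/funext => p /=; rewrite diffeoK.
Qed.

Definition Ad_pullback (x : smooth_section (pullback_tangent phi)) :
    smooth_section (pullback_tangent phi) :=
  section_of_operator phi (pb \o section_act x \o pbV).

Definition bracket_pullback (x y : smooth_section (pullback_tangent phi)) :
    smooth_section (pullback_tangent phi) :=
  section_of_operator phi (fun f =>
    (pb \o section_act x \o pbV \o section_act y \o pbV) f -
    (pb \o section_act y \o pbV \o section_act x \o pbV) f).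

Definition pullback_tangent_algebroid : hom_lie_algebroid_data phi :=
  HomLieAlgebroidData Ad_pullback bracket_pullback
    (id_bundle_map (pullback_tangent phi)).

End TangentAlgebroid.
End HomLieAlgebroids.

Arguments hla_hom {R n M phi} A x : rename.
Arguments hla_bracket {R n M phi} A x y : rename.

(* Main.v *)
(* Let P f = f o phi.  The representation axiom says a(phi_A x) P = P a(x) and
   a([x,y]) P = a(phi_A x) a(y) - a(phi_A y) a(x).  Composing with P^-1 on the
   right gives the required identities, but between operators on C^oo(M).  To
   return from operators to sections, one needs that a tangent vector is
   determined by its action on global smooth functions, hence bump functions. *)
Require Import Defs.
From mathcomp Require Import all_boot all_order all_algebra ring.
From mathcomp Require Import all_classical all_reals.
From mathcomp Require Import topology normedtype sequences derive exp realfun.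

Set Implicit Arguments.
Unset Strict Implicit.
Unset Printing Implicit Defensive.

Import Order.TTheory GRing.Theory Num.Theory.
Import numFieldNormedType.Exports.

Local Open Scope classical_set_scope.
Local Open Scope ring_scope.

(** * Smooth functions flat at the origin of the real line *)

Section FlatFunction.
Context {R : realType}.

Definition flat (m : nat) (s : R) : R :=
  if 0 < s then s^-1 ^+ m * expR (- s^-1) else 0.

(** The exponential dominates each single term of its Taylor series. *)
Lemma exp_flat_bound (m : nat) (t : R) : 0 < t ->
  t ^+ m.+1 * expR (- t) <= m.+1`!%:R.
Proof.
move=> t0; rewrite expRN ler_pdivrMr ?expR_gt0//.
have := expR_ge1Dxn m (ltW t0); rewrite -ler_pdivrMl ?ltr0n ?fact_gt0// mulrC.
by apply: le_trans; rewrite lerDr.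
Qed.

Lemma flat_ge0 m s : 0 <= flat m s.
Proof.
rewrite /flat; case: ifP => // s0.
by rewrite mulr_ge0 ?expR_ge0// exprn_ge0// invr_ge0 ltW.
Qed.

Lemma flat_gt0 m (s : R) : 0 < s -> 0 < flat m s.
Proof.
by move=> s0; rewrite /flat s0 mulr_gt0 ?expR_gt0// exprn_gt0// invr_gt0.
Qed.

(** This is [exp_flat_bound] at [s^-1], with two powers of [s] set aside so that the difference
    quotient at 0 tends to 0. *)
Lemma flat_le_sqr m s : flat m s <= m.+2`!%:R * s ^+ 2.
Proof.
rewrite /flat; case: ifP => [s0|_]; last by rewrite mulr_ge0 ?sqr_ge0.
have si : 0 < s^-1 by rewrite invr_gt0.
rewrite -ler_pdivrMr ?exprn_gt0// mulrAC -exprVn -exprD addn2.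
exact: exp_flat_bound.
Qed.

(* The derivative stays in the span of the functions [flat m]; this is why the
   exponent m is kept as a parameter. *)
Lemma is_derive_flat m (s : R) :
  is_derive s 1 (flat m) (flat m.+2 s - m%:R * flat m.+1 s).
Proof.
have [s0|s0|->] := ltgtP s 0.
- have -> : flat m.+2 s - m%:R * flat m.+1 s = 0.
    by rewrite /flat ltNge (ltW s0)/= mulr0 subr0.
  have H : \forall y \near s, cst 0 y = flat m y.
    near=> y; rewrite /flat ifF//; apply/negbTE; rewrite -leNgt ltW//.
    by near: y; exact: lt_nbhsl.
  by apply: (near_eq_is_derive H); exact: is_derive_cst.
- have H : \forall y \near s,
      ((fun y => y^-1) ^+ m * (expR \o (fun y => - y^-1))) y = flat m y.
    near=> y; rewrite /flat ifT; last by near: y; exact: lt_nbhsr.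
    by rewrite -[LHS]/(((fun z : R => z^-1) ^+ m) y * expR (- y^-1)) fctE.
  have dV : is_derive s 1 (fun y : R => y^-1) (- s ^- 2).
    have sn : id s != 0 :> R by rewrite gt_eqF.
    apply: DeriveDef; first exact: (derivableV (f := id) sn).
    by rewrite (deriveV (f := id) sn)// derive_id /GRing.scale /= mulr1.
  have dN : is_derive s 1 (fun y : R => - y^-1) (s ^- 2).
    by rewrite -[s ^- 2]opprK; exact: is_deriveN.
  have de := is_derive1_comp (f := expR) (g := fun y => - y^-1)
    (is_derive_expR _) dN.
  apply: (near_eq_is_derive H).
  apply: (is_derive_eq (is_deriveM (is_deriveX m dV) de)).
  rewrite /flat s0 /GRing.scale/= !fctE -!exprVn.
  case: m {H} => [|m] /=; [ring|rewrite !exprS; ring].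
- have -> : flat m.+2 0 - m%:R * flat m.+1 0 = 0.
    by rewrite /flat ltxx mulr0 subr0.
  pose q (h : R) : R := h^-1 *: ((flat m \o shift 0) (h *: 1) - flat m 0).
  have H : q @ 0^' --> (0 : R).
    have C h : 0 <= `|q h| <= m.+2`!%:R * `|h|.
      rewrite normr_ge0 /q /=.
      have -> : flat m 0 = 0 by rewrite /flat ltxx.
      rewrite subr0 addr0 [h *: 1]mulr1 normrZ (ger0_norm (flat_ge0 m h)).
      (* The bound also holds at [h = 0], where [q] vanishes because [0^-1 = 0]. *)
      have [->|h0] := eqVneq h 0; first by rewrite invr0 normr0 mul0r mulr0.
      rewrite normfV ler_pdivrMl ?normr_gt0// mulrCA -expr2.
      rewrite real_normK ?num_real//.
      exact: flat_le_sqr.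
    apply/norm_cvg0P.
    apply: (@squeeze_cvgr R (0^') _ R (fun=> 0) (fun h => m.+2`!%:R * `|h|)).
    + by apply: nearW => h; exact: C.
    + exact: cvg_cst.
    + have cv : m.+2`!%:R * `|h| @[h --> (0 : R)] --> m.+2`!%:R * `|0 : R|.
        by apply: cvgM; [exact: cvg_cst|apply: cvg_norm; exact: cvg_id].
      by move: cv; rewrite normr0 mulr0; exact: cvg_within_filter.
  by apply: DeriveDef; [apply/cvg_ex; exists 0|apply/cvg_lim].
Unshelve. all: by end_near. Qed.

(** The factor [c] lets the induction close: a directional derivative is a sum of two functions of
    this form, with coefficients depending on [v]. Rows of length 1 make [Ck_comp] applicable. *)
Lemma Ck_flat k m (c : R) :
  Ck k [set: 'rV[R]_1] (fun y => c * flat m (y 0 0)).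
Proof.
have D l (y : 'rV[R]_1) :
    differentiable (fun y : 'rV[R]_1 => flat l (y 0 0)) y /\
    forall v, 'd (fun y : 'rV[R]_1 => flat l (y 0 0)) y v =
      (flat l.+2 (y 0 0) - l%:R * flat l.+1 (y 0 0)) * v 0 0.
  have [df fE] := is_derive_flat l (y 0 0).
  have dfl := (derivable1_diffP _ _).1 df.
  have dc : differentiable (coord_row 0 : 'rV[R]_1 -> R) y.
    exact: differentiable_coord.
  split=> [|v]; first exact: (differentiable_comp dc dfl).
  rewrite (diff_comp_at v (erefl _) dc dfl).2 diff_lin; last first.
    exact: coord_row_continuous.
  by rewrite deriv1E//= derive1E fE; exact: mulrC.
elim: k m c => [|k IH] m c.
  move=> y _; apply: continuousM; first exact: cst_continuous.
  exact: (differentiable_continuous (D m y).1).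
split=> [y _|v].
  by apply: differentiableM; [exact: differentiable_cst|exact: (D m y).1].
apply: Ck_eq (CkD openT (IH m.+2 (c * v 0 0)) (IH m.+1 (- (c * m%:R * v 0 0)))).
  exact: openT.
move=> y _; have dfl := (D m y).1.
rewrite (@diffZ _ _ _ (fun y : 'rV[R]_1 => flat m (y 0 0)) c)//.
rewrite -[RHS]/(c * 'd (fun y : 'rV[R]_1 => flat m (y 0 0)) y v) (D m y).2.
ring.
Qed.

End FlatFunction.

(** * Bump functions in coordinate space *)

Section Separation.
Context {R : realType} {n : nat}.

Lemma smooth_flat_comp (U : set 'rV[R]_n) (g : 'rV[R]_n -> R) : open U ->
  smooth_on U g -> smooth_on U (flat 0 \o g).
Proof.
move=> oU sg k.
have := @Ck_comp R n 1 k U setT (fun x => \row__ g x) _ oU (fun=> fun=> I) _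
  (Ck_flat k 0 1).
have H (j : 'I_1) : Ck k U (fun x => (\row__ g x : 'rV[R]_1) 0 j).
  by apply: Ck_eq (sg k) => // x _; rewrite mxE.
by move/(_ H); apply: Ck_eq => // x _; rewrite /= mul1r mxE.
Qed.

(** The Euclidean norm is used, rather than the sup norm of the row space, because its square is a
    polynomial. *)
Definition ball_gap (x : 'rV[R]_n) (r : R) (y : 'rV[R]_n) : R :=
  r ^+ 2 - \sum_(j < n) (y 0 j - x 0 j) ^+ 2.

Definition bump_coord (x : 'rV[R]_n) (r : R) (l : 'I_n) (y : 'rV[R]_n) : R :=
  flat 0 (ball_gap x r y) * (y 0 l - x 0 l).

Implicit Types (x y v : 'rV[R]_n) (r : R) (l : 'I_n).

Lemma Ck_sub_coord k (x : 'rV[R]_n) j : Ck k setT (fun y => y 0 j - x 0 j).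
Proof.
exact: CkD openT (Ck_coord k j openT) (Ck_cst k (- x 0 j) openT).
Qed.

Lemma smooth_flat_gap x r : smooth_on setT (flat 0 \o ball_gap x r).
Proof.
apply: smooth_flat_comp openT _ => k; rewrite /ball_gap.
apply: CkD openT (Ck_cst _ _ openT) _.
have := CkM openT (Ck_cst k (-1) openT) (Ck_sum (index_enum 'I_n) openT
   (fun j => CkM openT (Ck_sub_coord k x j) (Ck_sub_coord k x j))).
by apply: Ck_eq openT _ => y _; rewrite mulN1r.
Qed.

Lemma smooth_bump_coord x r l : smooth_on setT (bump_coord x r l).
Proof.
by move=> k; apply: CkM openT (smooth_flat_gap x r k) (Ck_sub_coord _ _ _).
Qed.

(** A box containing the Euclidean ball; its compactness is that of a product of segments. *)
Definition cube x r : set 'rV[R]_n :=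
  [set y | forall j, y 0 j \in `[x 0 j - r, x 0 j + r]].

(** A single coordinate at distance more than [r] already makes [ball_gap] nonpositive. *)
Lemma bump_coord_out x r l y : 0 < r ->
  ~ cube x r y -> bump_coord x r l y = 0.
Proof.
move=> r0 /existsNP[j yj]; rewrite /bump_coord /flat /ball_gap ifF ?mul0r//.
apply/negbTE; rewrite -leNgt subr_le0 (bigD1 j)//=.
apply: (@le_trans _ _ ((y 0 j - x 0 j) ^+ 2)); last first.
  by rewrite lerDl sumr_ge0// => i _; exact: sqr_ge0.
rewrite -[leRHS]real_normK ?num_real// lerXn2r ?nnegrE ?(ltW r0)// leNgt.
by apply/negP => /ltW; rewrite ler_distl => ?; apply: yj; rewrite in_itv.
Qed.

(** In the Leibniz rule, the term differentiating the bump carries the centred coordinate, which is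
    0 at [x]. *)
Lemma diff_bump_coord x r l v : 0 < r ->
  'd (bump_coord x r l) x v = flat 0 (r ^+ 2) * v 0 l.
Proof.
move=> r0.
have dg : differentiable (flat 0 \o ball_gap x r) x.
  by have [+ _] := smooth_flat_gap x r 1%N; exact.
have dl : differentiable (fun y : 'rV[R]_n => y 0 l - x 0 l) x.
  by have [+ _] := Ck_sub_coord 1 x l; exact.
have E : 'd (fun y : 'rV[R]_n => y 0 l - x 0 l) x v = v 0 l.
  rewrite (@diffB _ _ _ (coord_row l) (cst (x 0 l)))//; last first.
    exact: differentiable_coord.
  rewrite diff_cst diff_lin; last exact: coord_row_continuous.
  by rewrite -[LHS]/(coord_row l v - 0) subr0.
rewrite (@diffM _ _ (flat 0 \o ball_gap x r) (fun y => y 0 l - x 0 l))//.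
rewrite -[LHS]/(
  flat 0 (ball_gap x r x) * 'd (fun y : 'rV[R]_n => y 0 l - x 0 l) x v
  + (x 0 l - x 0 l) * 'd (flat 0 \o ball_gap x r) x v).
rewrite E subrr mul0r addr0 /ball_gap big1 ?subr0// => j _.
by rewrite subrr expr0n.
Qed.

Lemma cube_nbhs (U : set 'rV[R]_n) (x : 'rV[R]_n) : nbhs x U ->
  exists2 r : R, 0 < r & cube x r `<=` U.
Proof.
move=> /nbhs_ballP[e /= e0 eU]; exists (e / 2); first by rewrite divr_gt0.
move=> y Hy; apply: eU; split=> // i j; rewrite ord1; have := Hy j.
rewrite -ball_normE/= in_itv/= -ler_distl distrC => /le_lt_trans; apply.
by rewrite ltr_pdivrMr// ltr_pMr// ltr1n.
Qed.

Lemma cube_compact x r : compact (cube x r).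
Proof.
exact: (@rV_compact R n (fun j => `[x 0 j - r, x 0 j + r]%classic)
  (fun j => segment_compact (a := _) (b := _))).
Qed.

(** * Global functions separate tangent vectors *)

Context (M : manifold R n).
Local Notation c := (@mf_chart R n M).
Local Notation dom i := (chart_dom (c i)).
Local Notation cinv i := (chart_inv (c i)).

(* Extension by 0 is smooth because the image of the compact K is closed in M,
   M being Hausdorff. *)
Lemma smooth_fun_extend0 i (K : set 'rV[R]_n) (g : 'rV[R]_n -> R) :
  compact K -> K `<=` c i @` dom i -> smooth_on setT g ->
  (forall y, ~ K y -> g y = 0) ->
  smooth_fun_on setT (fun p => if `[< dom i p >] then g (c i p) else 0).
Proof.
move=> cK KU sg g0; apply: smooth_fun_cover => p _.
have oi := chart_dom_open (c i).
have [di|ndi] := pselect (dom i p).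
  exists (dom i); split=> //.
  have H : smooth_on (c i @` (dom i `&` setT)) g.
    by move=> k; apply: Ck_sub (sg k).
  have := smooth_fun_chart openT H; rewrite setIT.
  by apply: smooth_fun_eq => // q dq; rewrite asboolT.
have cinvK : closed (cinv i @` K).
  apply: compact_closed; first exact: mf_hausdorff.
  apply: continuous_compact => //; apply: continuous_in_subspaceT => y.
  by rewrite inE => /KU; exact: chart_inv_continuous.
exists (~` (cinv i @` K)); split.
- exact: closed_openC.
- by move=> [y Ky yp]; apply: ndi; have [q dq qy] := KU _ Ky;
    rewrite -yp -qy chart_mapK.
- apply: smooth_fun_eq (smooth_fun_cst 0 _); try exact: closed_openC.
  move=> q nq; case: asboolP => // dq; rewrite g0// => Kq; apply: nq.
  by exists (c i q) => //; rewrite chart_mapK.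
Qed.

(** Take [bump_coord] on a cube inside the chart image, extended by 0; [a] is the value of the bump
    at its centre. *)
Lemma smooth_function_coord i q (l : 'I_n) : dom i q ->
  exists (f : smooth_function M) (a : R), a != 0 /\
    forall v : tangent q, tangent_act v f = a * v i 0 l.
Proof.
move=> di.
have nb : nbhs (c i q) (c i @` dom i).
  by apply: open_nbhs_nbhs; split; [exact: chart_im_open|exists q].
have [r r0 KU] := cube_nbhs nb.
exists (SmoothFunction (smooth_fun_extend0 (cube_compact (x := c i q) (r := r))
  KU (smooth_bump_coord _ r l) (fun y => bump_coord_out l r0))).
exists (flat 0 (r ^+ 2)); split.
  by rewrite gt_eqF// flat_gt0// exprn_gt0.
move=> v; rewrite (tangent_actE _ _ di)/= -(diff_bump_coord (c i q) l (v i) r0).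
have db : differentiable (bump_coord (c i q) r l) (c i q).
  by have [+ _] := smooth_bump_coord (c i q) r l 1%N; exact.
refine (congr1 (fun F => F (v i)) (near_eq_diff _ db).2).
apply: filterS nb => _ [p dp <-] /=.
by rewrite chart_mapK// asboolT.
Qed.

Lemma tangent_act_inj q (v w : tangent q) :
  (forall f : smooth_function M, tangent_act v f = tangent_act w f) -> v = w.
Proof.
move=> vw; apply: tangentP => i.
(* In a chart that misses [q], both components are 0 by convention. *)
have [di|ndi] := pselect (dom i q); last first.
  by rewrite (tangent_coordP v).1// (tangent_coordP w).1.
apply/rowP => l; have [f [a [a0 fE]]] := smooth_function_coord l di.
by have := vw f; rewrite !fE => /(mulfI a0).
Qed.

Lemma section_act_inj (phi : smooth_map M M) :
  injective (@section_act R n M phi).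
Proof.
move=> x y xy; apply: smooth_sectionP => p.
apply: (@tangent_act_inj (phi p)) => f.
exact: (congr1 (fun D : smooth_function M -> smooth_function M => D f p) xy).
Qed.

(** Since [x] itself realizes the operator, [xget] does not return its default; injectivity then
    identifies its choice with [x]. *)
Lemma section_actK (phi : smooth_map M M) :
  cancel (@section_act R n M phi) (section_of_operator phi).
Proof.
move=> x; apply: section_act_inj; rewrite /section_of_operator.
by apply: (xgetPex 0 (P := [set y | section_act y = section_act x])); exists x.
Qed.

End Separation.

(** * The anchor respects twists and brackets *)

Theorem proposition3p12 (R : realType) (n : nat) (M : manifold R n)
    (phi : diffeomorphism M) (A : hom_lie_algebroid_data phi)
    (hA : is_hom_lie_algebroid A) (hinv : bijective (hla_hom A)) :
  is_hla_morphism (B := pullback_tangent_algebroid phi) (hla_anchor A).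
Proof.
case: hA => _ _ _ [_ _ aphi abr].
pose a x := section_act (bm_section (hla_anchor A) x).
pose pb := pullback_fun phi; pose pbV := pullback_fun (diffeo_inv phi).
have aE x : a (hla_hom A x) = pb \o a x \o pbV.
  apply/funext => f; have /(congr1 (fun D => D (pbV f))) := aphi x.
  by rewrite /comp pullback_funVK.
(* The second representation axiom at [pbV f], with each [a (hla_hom A _)] expanded by [aE]. *)
have aB x y : a (hla_bracket A x y) = (fun f =>
    (pb \o a x \o pbV \o a y \o pbV) f - (pb \o a y \o pbV \o a x \o pbV) f).
  apply/funext => f; have /(congr1 (fun D => D (pbV f))) := abr x y.
  by rewrite -/(a _) /comp pullback_funVK => ->; rewrite -!/(a _) !aE.
(* The target has the identity as anchor, so compatibility of anchors is immediate. *)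
split=> // [x|x y] /=.
  by rewrite /Ad_pullback -[X in section_of_operator _ X]aE section_actK.
by rewrite /bracket_pullback -[X in section_of_operator _ X]aB section_actK.
Qed.
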